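(* Every lacunary sequence belongs to a co-minimal pair in the integers. That is, for every lacunary sequence $X\subseteq\mathbb{Z}$ there exists $W\subseteq \mathbb{Z}$ such that $X$ is a minimal additive complement to $W$ and $W$ is a minimal additive complement to $X$.
   Context: $\mathbb{N}=\{1,2,3,\dots\}$. A lacunary sequence is a subset $\{x_n\}_{n\in\mathbb{N}}$ of the positive integers such that, for some real constant $\lambda>1$, $\frac{x_{n+1}}{x_n}\ge \lambda$ for all $n\in\mathbb{N}$. For $A,B\subseteq\mathbb{Z}$, $A+B=\{a+b: a\in A, b\in B\}$. $A$ is a minimal additive complement to $B$ (in $\mathbb{Z}$) if $A+B=\mathbb{Z}$ and $A'+B\ne\mathbb{Z}$ for every proper subset $A'\subsetneq A$. A pair $A,B$ is a co-minimal pair if each is a minimal additive complement to the other; a set belongs to a co-minimal pair if it is one of the members of such a pair. *)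

(* Defs.v *)
From mathcomp Require Import all_boot all_order all_algebra.
From mathcomp Require Import boolp classical_sets reals.

Set Implicit Arguments.
Unset Strict Implicit.
Unset Printing Implicit Defensive.

Import Order.TTheory GRing.Theory Num.Theory.
Local Open Scope classical_set_scope.
Local Open Scope ring_scope.

(* Terms are indexed from 0, so that x_1, x_2, ... is x 0, x 1, ... *)
Definition lacunary (R : realType) (X : set int) : Prop :=
  exists x : nat -> int,
    [/\ X = range x,
        forall n : nat, 0 < x n
      & exists2 lam : R, 1 < lam &
          forall n : nat, lam <= (x n.+1)%:~R / (x n)%:~R].

Definition sumset (A B : set int) : set int :=
  [set a + b | a in A & b in B].

Definition minimal_additive_complement (A B : set int) : Prop :=
  sumset A B = setT /\
  forall A' : set int, A' `<` A -> sumset A' B <> setT.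

Definition co_minimal_pair (A B : set int) : Prop :=
  minimal_additive_complement A B /\ minimal_additive_complement B A.

(* Main.v *)
(** A pair [(w, n)] stands for a translate [w] together with the promise that
    the integer [w + x n] is represented in no other way in [W + X].  If all
    promises are kept, every [w] and every [x n] occurring in some pair is
    indispensable.  Finitely many promises can always be extended: since the
    gaps of [X] tend to infinity, a nonzero integer is a difference of two
    terms of [X] in only finitely many ways, so an uncovered [z] can be covered
    by [z - x n] with [n] large, and a given [x n] can be made indispensable by
    a very negative translate.  Alternating the two kinds of extension
    exhausts both [Z] and [X]. *)
Require Import Defs.
From mathcomp Require Import all_boot all_order all_algebra.
From mathcomp Require Import boolp classical_sets reals.
From mathcomp Require Import zify.

Set Implicit Arguments.
Unset Strict Implicit.
Unset Printing Implicit Defensive.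

Import Order.TTheory GRing.Theory Num.Theory.
Local Open Scope classical_set_scope.
Local Open Scope ring_scope.

Definition gaps_diverge (x : nat -> int) : Prop :=
  forall d : int, exists N, forall n, (N <= n)%N -> d < x n.+1 - x n.

Lemma lacunary_increasing (R : realType) (lam : R) (x : nat -> int) :
  1 < lam -> (forall n, 0 < x n) ->
  (forall n, lam <= (x n.+1)%:~R / (x n)%:~R) ->
  {homo x : m n / (m < n)%N >-> m < n}.
Proof.
move=> lam1 x0 xlam; apply: homo_ltn => [|n]; first exact: lt_trans.
have xn0 : 0 < (x n)%:~R :> R by rewrite ltr0z.
rewrite -(ltr_int R); apply: lt_le_trans (_ : lam * (x n)%:~R <= _).
  by rewrite ltr_pMl.
by rewrite -ler_pdivlMr.
Qed.

(** The ratio bound gives [x n.+1 - x n >= (lam - 1) * x n], and [x n >= n] since [x] is a strictly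
    increasing sequence of positive integers. *)
Lemma lacunary_gaps_diverge (R : realType) (lam : R) (x : nat -> int) :
  1 < lam -> (forall n, 0 < x n) ->
  (forall n, lam <= (x n.+1)%:~R / (x n)%:~R) -> gaps_diverge x.
Proof.
move=> lam1 x0 xlam d.
have xS := lacunary_increasing lam1 x0 xlam.
have len n : n%:Z <= x n.
  elim: n => [|n IHn]; first exact: ltW.
  by have := xS _ _ (ltnSn n); lia.
have lam0 : 0 < lam - 1 by rewrite subr_gt0.
pose N := Num.bound (`|d|%:~R / (lam - 1)).
exists N => n Nn.
have xn0 : 0 < (x n)%:~R :> R by rewrite ltr0z.
rewrite -(ltr_int R) rmorphB /=.
apply: lt_le_trans (_ : (lam - 1) * (x n)%:~R <= _); last first.
  by rewrite mulrBl mul1r lerD2r -ler_pdivlMr.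
apply: le_lt_trans (_ : `|d|%:~R < _); first by rewrite ler_int ler_norm.
rewrite mulrC -ltr_pdivrMr //.
have dN : `|d|%:~R / (lam - 1) < N%:R.
  apply: archi_boundP; apply: divr_ge0; last exact: ltW.
  by rewrite ler0z.
apply: lt_le_trans dN _.
by rewrite -[N%:R]/(N%:Z%:~R) ler_int (le_trans _ (len n)).
Qed.

Section Increasing.

Variable x : nat -> int.
Hypothesis x_gt0 : forall n, 0 < x n.
Hypothesis x_incr : {homo x : m n / (m < n)%N >-> m < n}.
Hypothesis x_gaps : gaps_diverge x.

Lemma differences_avoid (d : int) : d != 0 ->
  exists N, forall n m, (N <= n)%N -> x m - x n != d.
Proof.
move=> d0; have [N gapN] := x_gaps `|d|.
have xle i j : (i <= j)%N -> x i <= x j.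
  by rewrite leq_eqVlt => /predU1P[->//|/x_incr/ltW].
(* The shift to [N.+1] makes the gap just below the term exceed [|d|] as well as the gap just above
   it. *)
exists N.+1 => -[//|n] m Nn; have := gapN _ Nn.
have := gapN _ (leqW Nn).
case: (ltngtP m n.+1) => [|/xle|->]; last by lia.
  by rewrite ltnS => /xle; lia.
by lia.
Qed.

Lemma differences_avoid_seq (ds : seq int) : 0 \notin ds ->
  exists N, forall d m, d \in ds -> x m - x N != d.
Proof.
move=> ds0.
(* The induction needs avoidance at all large indices, so that the maximum of two thresholds serves
   both the head and the tail. *)
suff [N HN] : exists N, forall n d m, (N <= n)%N -> d \in ds -> x m - x n != d.
  by exists N => d m; apply: HN.
elim: ds ds0 => [|d ds IHds]; first by exists 0.
rewrite in_cons negb_or eq_sym.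
move=> /andP[/differences_avoid[N1 HN1] /IHds[N2 HN2]].
exists (maxn N1 N2) => n e m; rewrite geq_max in_cons => /andP[n1 n2].
by case/predU1P => [->|]; [exact: HN1 | exact: HN2].
Qed.

Definition promise (p : int * nat) : int := p.1 + x p.2.

(** Taking [m] to be [p.2] shows that distinct pairs have distinct translates. Within one translate,
    strict growth of [x] makes representations unique. *)
Definition compatible (S : set (int * nat)) : Prop :=
  forall p q, S p -> S q -> p <> q -> forall m, promise p <> q.1 + x m.

Lemma compatible_cons (p : int * nat) (s : seq (int * nat)) :
  compatible [set` s] ->
  (forall q m, q \in s -> promise p <> q.1 + x m) ->
  (forall q m, q \in s -> promise q <> p.1 + x m) ->
  compatible [set` p :: s].
Proof.
move=> cs ps sp q r /=; rewrite !in_cons => /predU1P[->|qs] /predU1P[->|rs] //.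
- by move=> _ m; apply: ps.
- by move=> _ m; apply: sp.
- exact: cs.
Qed.

Lemma extend_cover (s : seq (int * nat)) (z : int) : compatible [set` s] ->
  exists t : seq (int * nat), [/\ compatible [set` t], {subset s <= t}
    & exists (p : int * nat) m, p \in t /\ p.1 + x m = z].
Proof.
move=> cs.
have [[p [m [ps pz]]]|uncovered] :=
  pselect (exists (p : int * nat) m, p \in s /\ p.1 + x m = z).
  by exists s; split=> //; exists p, m.
have [|N HN] := @differences_avoid_seq [seq promise q - z | q <- s].
  apply/mapP => -[q qs /eqP]; rewrite eq_sym subr_eq0 => /eqP qz.
  by apply: uncovered; exists q, q.2.
(* The new promise is [z] itself, which no old translate reaches. The new translate meets an old
   promise only if [x m - x N = promise q - z], a nonzero difference that [N] avoids. *)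
exists ((z - x N, N) :: s); split.
- apply: compatible_cons => // q m qs.
    by rewrite /promise /= subrK => zq; apply: uncovered; exists q, m.
  move=> /= qm; have /negP := HN _ m (map_f (fun q => promise q - z) qs).
  by apply; rewrite qm; apply/eqP; lia.
- by move=> q qs; rewrite in_cons qs orbT.
- by exists (z - x N, N), N; rewrite mem_head /= subrK.
Qed.

Lemma lower_bound_seq (us : seq int) :
  exists c : int, forall u, u \in us -> c < u.
Proof.
elim: us => [|u us [c Hc]]; first by exists 0.
exists (Num.min c (u - 1)) => v; rewrite in_cons => /predU1P[->|/Hc]; lia.
Qed.

Lemma extend_index (s : seq (int * nat)) (n : nat) : compatible [set` s] ->
  exists t : seq (int * nat), [/\ compatible [set` t], {subset s <= t}
    & exists w, (w, n) \in t].
Proof.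
move=> cs.
have [c1 Hc1] := lower_bound_seq [seq q.1 - x n | q <- s].
have [c2 Hc2] := lower_bound_seq [seq promise q | q <- s].
(* Below all old promises, [c] makes each [promise q - c] nonzero, hence avoidable. Below all
   [q.1 - x n], it puts the new promise [c - x N + x n] under every [q.1 + x m]. *)
pose c := Num.min c1 c2.
have [|N HN] := @differences_avoid_seq [seq promise q - c | q <- s].
  by apply/mapP => -[q /(map_f promise)/Hc2]; lia.
exists ((c - x N, n) :: s); split.
- apply: compatible_cons => // q m qs; rewrite /promise /=.
    have /= := Hc1 _ (map_f (fun q => q.1 - x n) qs).
    by have := x_gt0 N; have := x_gt0 m; lia.
  move=> qm; have /negP := HN _ m (map_f (fun q => promise q - c) qs).
  by apply; rewrite /promise qm; apply/eqP; lia.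
- by move=> q qs; rewrite in_cons qs orbT.
- by exists (c - x N); rewrite mem_head.
Qed.

(** Step [k] secures a promise for index [k], then covers the integer with code [k], if there is
    one. [S] is the union of the resulting chain of finite lists. *)
Lemma exists_compatible_exhausting : exists S : set (int * nat),
  [/\ compatible S, forall n, exists w, S (w, n)
    & forall z, exists p m, S p /\ p.1 + x m = z].
Proof.
pose T := {s : seq (int * nat) | compatible [set` s]}.
have step (k : nat) (s : T) : exists t : T, [/\ {subset sval s <= sval t},
    exists w, (w, k) \in sval t
  & forall z, unpickle k = Some z ->
      exists (p : int * nat) m, p \in sval t /\ p.1 + x m = z].
  case: s => s /= cs; have [t [ct st tk]] := extend_index k cs.
  case: (unpickle k) => [z|]; last by exists (exist _ t ct); split.
  have [u [cu tu uz]] := extend_cover z ct.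
  exists (exist _ u cu); split=> /= [q /st/tu//||_ [<-]//].
  by case: tk => w /tu; exists w.
have [f Hf] := choice (fun ks : nat * T => step ks.1 ks.2).
have c0 : compatible [set` [::]] by [].
pose F := fix F k : T := if k is k'.+1 then f (k', F k') else exist _ [::] c0.
have FS i j : (i <= j)%N -> {subset sval (F i) <= sval (F j)}.
  move=> ij; rewrite -(subnK ij); elim: (j - i)%N => // k IHk q /IHk.
  by case: (Hf ((k + i)%N, F (k + i)%N)) => + _ _; apply.
exists [set p | exists k, p \in sval (F k)]; split.
(* Compatibility concerns two pairs at a time, and both lie in a common stage. *)
- move=> p q [i pi] [j qj]; apply: (svalP (F (maxn i j))) => /=.
    exact: FS (leq_maxl i j) _ pi.
  exact: FS (leq_maxr i j) _ qj.
- by move=> n; case: (Hf (n, F n)) => _ [w wn] _; exists w, n.+1.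
- move=> z; case: (Hf (pickle z, F (pickle z))) => _ _ /(_ z (pickleK z)).
  by move=> [p [m [pF pz]]]; exists p, m; split=> //; exists (pickle z).+1.
Qed.

End Increasing.

Lemma sumsetC (A B : set int) : sumset A B = sumset B A.
Proof.
by apply/seteqP; split=> _ [a Aa [b Bb <-]]; exists b => //; exists a;
  rewrite // addrC.
Qed.

(** Dropping [a] loses the sum [a + b], since all its representations use [a]. *)
Lemma minimal_of_unique_sums (A B : set int) :
  sumset A B = setT ->
  (forall a, A a -> exists2 b, B b &
    forall a' b', A a' -> B b' -> a' + b' = a + b -> a' = a) ->
  minimal_additive_complement A B.
Proof.
move=> AB unique; split=> // A' [A'A AA'] A'B; apply: AA' => a Aa.
have [b Bb abU] := unique a Aa.
have : sumset A' B (a + b) by rewrite A'B.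
move=> [a' A'a' [b' Bb' ab]].
by rewrite -(abU a' b' (A'A _ A'a') Bb' ab).
Qed.

Theorem corollary1 (R : realType) (X : set int) (hX : lacunary R X) :
  exists W : set int, co_minimal_pair X W.
Proof.
have [x [-> x_gt0 [lam lam1 xlam]]] := hX.
have x_incr := lacunary_increasing lam1 x_gt0 xlam.
have [S [cS Sn Sz]] := exists_compatible_exhausting x_gt0 x_incr
  (lacunary_gaps_diverge lam1 x_gt0 xlam).
have WX : sumset [set p.1 | p in S] (range x) = setT.
  apply/seteqP; split=> // z _; have [p [m [Sp pz]]] := Sz z.
  by exists p.1; [exists p | exists (x m)].
have unique p q m : S p -> S q -> q.1 + x m = promise x p -> q = p.
  by move=> Sp Sq e; apply: contrapT => /nesym pq; apply: (cS p q Sp Sq pq m).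
exists [set p.1 | p in S]; split; apply: minimal_of_unique_sums => //.
- by rewrite sumsetC.
(* The promise at [w + x n] forces the translate [w], and cancelling it leaves [x m = x n]. *)
- move=> _ [n _ <-]; have [w Swn] := Sn n; exists w; first by exists (w, n).
  move=> _ _ [m _ <-] [q Sq <-]; rewrite addrC [RHS]addrC => e.
  by have qE := unique _ _ _ Swn Sq e; move: e; rewrite qE => /addrI.
- move=> _ [p Sp <-]; exists (x p.2); first by exists p.2.
  by move=> _ _ [q Sq <-] [m _ <-] /(unique _ _ _ Sp Sq) ->.
Qed.
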